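(* Every equation in the language of $\ell$-pregroups that fails in a diagram also fails in $\mathbf{F}_{\textup{fs}}(\mathbb{Z})$.
   Context: $\mathbf{F}(\mathbb{Z})$ is the distributive $\ell$-pregroup of all order-preserving maps on the chain $\mathbb{Z}$ having residuals and dual residuals of all orders (equivalently, finite-to-one order-preserving maps), under composition, pointwise order, and $f^{\ell}$, $f^{r}$ the dual residual and residual. $\mathbf{F}_{\textup{fs}}(\mathbb{Z})$ is its subalgebra of functions of finite support (equal to the identity except at finitely many points). Write $x^{(0)}=x$, $x^{(m)}=x^{\ell^m}$, $x^{(-m)}=x^{r^m}$ for $m\in\mathbb{Z}^+$. Every equation is equivalent over distributive $\ell$-pregroups to one in intentional form $1\leq w_1\vee\cdots\vee w_k$ over variables $x_1,\ldots,x_n$, each $w_j$ a product of terms $x_i^{(m)}$; failure of an arbitrary equation in a diagram is understood via this form. A c-chain is a triple $(\Delta,\leq,\lessdot)$ with $(\Delta,\leq)$ a finite chain and $\lessdot$ a subset of its covering relation. For an order-preserving partial function $g$ on it: $(x,b)\in g^{[\ell]}$ iff $b\in Dom(g)$ and some $a\in Dom(g)$ has $a\lessdot b$ and $g(a)<x\leq g(b)$; $(x,a)\in g^{[r]}$ iff $a\in Dom(g)$ and some $b\in Dom(g)$ has $a\lessdot b$ and $g(a)\leq x<g(b)$. $\mathbf{Pf}(\mathbf{\Delta})$ is the algebra of order-preserving partial functions under composition, $^{[\ell]}$, $^{[r]}$ and identity. A diagram $(\mathbf{\Delta},f_1,\ldots,f_n)$ is a finite c-chain with order-preserving partial functions $f_1,\ldots,f_n$;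 the equation $1\leq w_1\vee\cdots\vee w_k$ fails in it if there is a homomorphism $\psi$ from intentional terms (multiplication, $1$, iterated inverses) to $\mathbf{Pf}(\mathbf{\Delta})$ with $\psi(x_i)=f_i$ and a point $p\in\Delta$ with $\psi(1)(p)>\psi(w_j)(p)$ for all $j$. *)

(* Defs.v *)
From HB Require Import structures.
From mathcomp Require Import all_boot all_order all_algebra.
From mathcomp Require Import zify.
From mathcomp Require Import boolp classical_sets cardinality.

Set Implicit Arguments.
Unset Strict Implicit.
Unset Printing Implicit Defensive.

Import Order.TTheory GRing.Theory Num.Theory.
Import monoid.

(* The inverses x^l and x^r are written [linv x] and [rinv x]. *)
HB.mixin Record isLPregroup d T of Order.Lattice d T & monoid.Monoid T := {
  linv : T -> T;
  rinv : T -> T;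
  lpg_leM2l : forall x y z : T, (x <= y)%O -> (z * x <= z * y)%g%O;
  lpg_leM2r : forall x y z : T, (x <= y)%O -> (x * z <= y * z)%g%O;
  lpg_mulVl : forall x : T, (linv x * x <= 1 :> T)%g%O;
  lpg_mullV : forall x : T, (1 <= x * linv x :> T)%g%O;
  lpg_mulrV : forall x : T, (x * rinv x <= 1 :> T)%g%O;
  lpg_mulVr : forall x : T, (1 <= rinv x * x :> T)%g%O;
}.

#[short(type="lpregroupType")]
HB.structure Definition LPregroup d :=
  {T of isLPregroup d T & Order.Lattice d T & monoid.Monoid T}.

#[short(type="distrLPregroupType")]
HB.structure Definition DistrLPregroup d :=
  {T of LPregroup d T & Order.DistrLattice d T}.

Inductive term (V : Type) : Type :=
| TVar of V
| TOne
| TMul of term V & term V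
| TMeet of term V & term V
| TJoin of term V & term V
| TLinv of term V
| TRinv of term V.

Arguments TOne {V}.

Fixpoint teval d (A : lpregroupType d) (V : Type) (v : V -> A) (t : term V) : A :=
  match t with
  | TVar x => v x
  | TOne => 1%g
  | TMul s t => (teval v s * teval v t)%g
  | TMeet s t => (teval v s `&` teval v t)%O
  | TJoin s t => (teval v s `|` teval v t)%O
  | TLinv t => linv (teval v t)
  | TRinv t => rinv (teval v t)
  end.

Record equation (V : Type) := Equation { lhs : term V; rhs : term V }.

Definition valid d (A : lpregroupType d) (V : Type) (e : equation V) : Prop :=
  forall v : V -> A, teval v (lhs e) = teval v (rhs e).

Definition fails_in d (A : lpregroupType d) (V : Type) (e : equation V) : Prop :=
  exists v : V -> A, teval v (lhs e) <> teval v (rhs e).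

Definition dlp_equivalent (V W : Type) (e : equation V) (e' : equation W) : Prop :=
  forall d (A : distrLPregroupType d), valid A e <-> valid A e'.

Inductive iterm (n : nat) : Type :=
| IVar of 'I_n
| IOne
| IMul of iterm n & iterm n
| ILinv of iterm n
| IRinv of iterm n.

Arguments IOne {n}.

Fixpoint term_of_iterm n (t : iterm n) : term 'I_n :=
  match t with
  | IVar i => TVar i
  | IOne => TOne
  | IMul s t => TMul (term_of_iterm s) (term_of_iterm t)
  | ILinv t => TLinv (term_of_iterm t)
  | IRinv t => TRinv (term_of_iterm t)
  end.

(* x_i^(m) *)
Definition ipow n (i : 'I_n) (m : int) : iterm n :=
  match m with
  | Posz k => iter k (@ILinv n) (IVar i)
  | Negz k => iter k.+1 (@IRinv n) (IVar i)
  end.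

Definition iprod n (w : seq ('I_n * int)) : iterm n :=
  foldr (fun im t => IMul (ipow im.1 im.2) t) IOne w.

(* [IEquation w ws] stands for 1 <= w \/ w' \/ w'' \/ ... , where w', w'', ... *)
(* are the members of [ws]; the sequence (i_1, m_1), (i_2, m_2), ... stands    *)
(* for the product x_(i_1)^(m_1) x_(i_2)^(m_2) ...                             *)
Record iequation (n : nat) :=
  IEquation { ihead : seq ('I_n * int); itail : seq (seq ('I_n * int)) }.

Definition ijoin n (e : iequation n) : term 'I_n :=
  foldl (fun t w => TJoin t (term_of_iterm (iprod w)))
    (term_of_iterm (iprod (ihead e))) (itail e).

(* s <= t abbreviates the equation s = s /\ t. *)
Definition equation_of_iequation n (e : iequation n) : equation 'I_n :=
  Equation TOne (TMeet TOne (ijoin e)).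

Definition covered d (T : finOrderType d) : rel T :=
  fun a b => ((a < b)%O && [forall c : T, ~~ ((a < c)%O && (c < b)%O)])%B.

Record cchain := CChain {
  cc_disp : Order.disp_t;
  cc_sort :> finOrderType cc_disp;
  cc_cov : rel cc_sort;
  cc_covP : forall a b, cc_cov a b -> covered a b
}.

Definition pf_homo (C : cchain) (g : {ffun C -> option C}) : bool :=
  [forall x, forall y, (x <= y)%O ==>
    (if g x is Some a then if g y is Some b then (a <= b)%O else true else true)].

Record pfun (C : cchain) :=
  PFun { pf_val :> {ffun C -> option C}; pf_valP : pf_homo pf_val }.

HB.instance Definition _ (C : cchain) := [isSub for @pf_val C].
HB.instance Definition _ (C : cchain) := [Finite of pfun C by <:].

Lemma pf_homoP (C : cchain) (g : {ffun C -> option C}) :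
  reflect (forall x y a b, (x <= y)%O -> g x = Some a -> g y = Some b -> (a <= b)%O)
    (pf_homo g).
Proof.
apply: (iffP forallP) => [H x y a b xy gx gy|H x].
  by move/forallP: (H x) => /(_ y)/implyP/(_ xy); rewrite gx gy.
apply/forallP => y; apply/implyP => xy.
case E: (g x) => [a|] //; case E': (g y) => [b|] //; exact: H xy E E'.
Qed.

Definition pf_id_fun (C : cchain) : {ffun C -> option C} := [ffun x => Some x].

Definition pf_mul_fun (C : cchain) (f g : {ffun C -> option C}) :
  {ffun C -> option C} := [ffun x => obind f (g x)].

(* g^[l] and g^[r]; see [pf_linv_funP] and [pf_rinv_funP] *)
Definition pf_linv_fun (C : cchain) (g : {ffun C -> option C}) :
    {ffun C -> option C} :=
  [ffun x => [pick b | [exists a, [&& cc_cov a b,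
    (if g a is Some u then (u < x)%O else false) &
    (if g b is Some v then (x <= v)%O else false)]]]].

Definition pf_rinv_fun (C : cchain) (g : {ffun C -> option C}) :
    {ffun C -> option C} :=
  [ffun x => [pick a | [exists b, [&& cc_cov a b,
    (if g a is Some u then (u <= x)%O else false) &
    (if g b is Some v then (x < v)%O else false)]]]].

Lemma cc_cov_le (C : cchain) (a b c : C) : cc_cov a b -> (c < b)%O -> (c <= a)%O.
Proof.
move=> /cc_covP/andP[_ /forallP/(_ c)]; rewrite negb_and.
by case: (ltP a c) => //= _ /negbTE ->.
Qed.

Lemma cc_cov_ge (C : cchain) (a b c : C) : cc_cov a b -> (a < c)%O -> (b <= c)%O.
Proof.
move=> /cc_covP/andP[_ /forallP/(_ c)]; rewrite negb_and => /orP[/negbTE -> //|].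
by rewrite -leNgt.
Qed.

Lemma pf_linv_mono (C : cchain) (g : {ffun C -> option C}) (x x' a b a' b' u v u' v' : C) :
  pf_homo g -> (x <= x')%O ->
  cc_cov a b -> g a = Some u -> g b = Some v -> (u < x)%O -> (x <= v)%O ->
  cc_cov a' b' -> g a' = Some u' -> g b' = Some v' -> (u' < x')%O -> (x' <= v')%O ->
  (b <= b')%O.
Proof.
move=> /pf_homoP gh xx' ab ga gb ux xv ab' ga' gb' ux' xv'.
rewrite leNgt; apply/negP => /(cc_cov_le ab) b'a.
have := gh _ _ _ _ b'a gb' ga; rewrite leNgt => /negP; apply.
exact: lt_le_trans ux (le_trans xx' xv').
Qed.

Lemma pf_rinv_mono (C : cchain) (g : {ffun C -> option C}) (x x' a b a' b' u v u' v' : C) :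
  pf_homo g -> (x <= x')%O ->
  cc_cov a b -> g a = Some u -> g b = Some v -> (u <= x)%O -> (x < v)%O ->
  cc_cov a' b' -> g a' = Some u' -> g b' = Some v' -> (u' <= x')%O -> (x' < v')%O ->
  (a <= a')%O.
Proof.
move=> /pf_homoP gh xx' ab ga gb ux xv ab' ga' gb' ux' xv'.
rewrite leNgt; apply/negP => /(cc_cov_ge ab') b'a.
have := gh _ _ _ _ b'a gb' ga; rewrite leNgt => /negP; apply.
exact: le_lt_trans (le_trans ux xx') xv'.
Qed.

Lemma pf_linv_fun_some (C : cchain) (g : {ffun C -> option C}) (x b : C) :
  pf_linv_fun g x = Some b -> exists a u v,
    [/\ cc_cov a b, g a = Some u, g b = Some v, (u < x)%O & (x <= v)%O].
Proof.
rewrite ffunE; case: pickP => // c /existsP[a /and3P[ac]].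
case ga: (g a) => [u|] // ux; case gc: (g c) => [v|] // xv [<-].
by exists a, u, v.
Qed.

Lemma pf_rinv_fun_some (C : cchain) (g : {ffun C -> option C}) (x a : C) :
  pf_rinv_fun g x = Some a -> exists b u v,
    [/\ cc_cov a b, g a = Some u, g b = Some v, (u <= x)%O & (x < v)%O].
Proof.
rewrite ffunE; case: pickP => // c /existsP[b /and3P[cb]].
case gc: (g c) => [u|] // ux; case gb: (g b) => [v|] // xv [<-].
by exists b, u, v.
Qed.

Lemma pf_linv_funP (C : cchain) (g : {ffun C -> option C}) (x b : C) :
  pf_homo g ->
  pf_linv_fun g x = Some b <-> exists a u v,
    [/\ cc_cov a b, g a = Some u, g b = Some v, (u < x)%O & (x <= v)%O].
Proof.
move=> gh; split=> [|[a [u [v [ab ga gb ux xv]]]]]; first exact: pf_linv_fun_some.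
case E: (pf_linv_fun g x) => [c|].
  have [a' [u' [v' [ac ga' gc ux' xv']]]] := pf_linv_fun_some E.
  congr Some; apply: le_anti; apply/andP; split.
    exact: (pf_linv_mono gh (lexx x) ac ga' gc ux' xv' ab ga gb ux xv).
  exact: (pf_linv_mono gh (lexx x) ab ga gb ux xv ac ga' gc ux' xv').
move: E; rewrite ffunE; case: pickP => // /(_ b)/negbT/existsP[].
by exists a; rewrite ab ga gb ux xv.
Qed.

Lemma pf_rinv_funP (C : cchain) (g : {ffun C -> option C}) (x a : C) :
  pf_homo g ->
  pf_rinv_fun g x = Some a <-> exists b u v,
    [/\ cc_cov a b, g a = Some u, g b = Some v, (u <= x)%O & (x < v)%O].
Proof.
move=> gh; split=> [|[b [u [v [ab ga gb ux xv]]]]]; first exact: pf_rinv_fun_some.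
case E: (pf_rinv_fun g x) => [c|].
  have [b' [u' [v' [cb gc gb' ux' xv']]]] := pf_rinv_fun_some E.
  congr Some; apply: le_anti; apply/andP; split.
    exact: (pf_rinv_mono gh (lexx x) cb gc gb' ux' xv' ab ga gb ux xv).
  exact: (pf_rinv_mono gh (lexx x) ab ga gb ux xv cb gc gb' ux' xv').
move: E; rewrite ffunE; case: pickP => // /(_ a)/negbT/existsP[].
by exists b; rewrite ab ga gb ux xv.
Qed.

Lemma pf_id_homo (C : cchain) : pf_homo (pf_id_fun C).
Proof. by apply/pf_homoP => x y a b xy; rewrite !ffunE => -[<-] [<-]. Qed.

Lemma pf_mul_homo (C : cchain) (f g : pfun C) : pf_homo (pf_mul_fun f g).
Proof.
apply/pf_homoP => x y a b xy; rewrite !ffunE.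
case gx: (pf_val g x) => [u|] //=; case gy: (pf_val g y) => [v|] //=.
by apply: (pf_homoP _ (pf_valP f)); apply: (pf_homoP _ (pf_valP g)) gx gy.
Qed.

Lemma pf_linv_homo (C : cchain) (g : pfun C) : pf_homo (pf_linv_fun g).
Proof.
apply/pf_homoP => x y b b' xy.
move=> /pf_linv_fun_some [a [u [v [ab ga gb ux xv]]]].
move=> /pf_linv_fun_some [a' [u' [v' [ab' ga' gb' ux' xv']]]].
exact: pf_linv_mono (pf_valP g) xy ab ga gb ux xv ab' ga' gb' ux' xv'.
Qed.

Lemma pf_rinv_homo (C : cchain) (g : pfun C) : pf_homo (pf_rinv_fun g).
Proof.
apply/pf_homoP => x y a a' xy.
move=> /pf_rinv_fun_some [b [u [v [ab ga gb ux xv]]]].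
move=> /pf_rinv_fun_some [b' [u' [v' [ab' ga' gb' ux' xv']]]].
exact: pf_rinv_mono (pf_valP g) xy ab ga gb ux xv ab' ga' gb' ux' xv'.
Qed.

Definition pf_id (C : cchain) : pfun C := PFun (pf_id_homo C).
Definition pf_mul (C : cchain) (f g : pfun C) : pfun C := PFun (pf_mul_homo f g).
Definition pf_linv (C : cchain) (g : pfun C) : pfun C := PFun (pf_linv_homo g).
Definition pf_rinv (C : cchain) (g : pfun C) : pfun C := PFun (pf_rinv_homo g).

Record diagram (n : nat) :=
  Diagram { dchain : cchain; dfun : 'I_n -> pfun dchain }.

Definition intentional_hom n (C : cchain) (psi : iterm n -> pfun C) : Prop :=
  [/\ psi IOne = pf_id C,
      forall s t, psi (IMul s t) = pf_mul (psi s) (psi t),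
      forall t, psi (ILinv t) = pf_linv (psi t) &
      forall t, psi (IRinv t) = pf_rinv (psi t)].

(* psi(1)(p) > psi(w)(p) includes that both sides are defined. *)
Definition ifails_in_diagram n (e : iequation n) (D : diagram n) : Prop :=
  exists psi : iterm n -> pfun (dchain D),
    [/\ intentional_hom psi,
        forall i, psi (IVar i) = dfun D i &
        exists p : dchain D, forall w, w \in ihead e :: itail e ->
          exists a b,
            [/\ psi IOne p = Some a, psi (iprod w) p = Some b & (b < a)%O]].

(* A general equation fails in a diagram through an equation in intentional    *)
(* form that is equivalent to it over distributive l-pregroups and whose       *)
(* variables are those of the diagram.                                         *)
Definition fails_in_diagram (V : Type) (e : equation V) n (D : diagram n) : Prop :=
  exists i : iequation n,
    dlp_equivalent e (equation_of_iequation i) /\ ifails_in_diagram i D.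

(* g is the dual residual of f, and f is the residual of g *)
Definition residual_pair (g f : int -> int) : Prop :=
  forall x y : int, (g x <= y)%O = (x <= f y)%O.

(* F m is the m-th iterate of the dual residual of f for m >= 0, and the      *)
(* (-m)-th iterate of its residual for m <= 0                                 *)
Definition has_all_residuals (f : int -> int) : Prop :=
  exists F : int -> int -> int,
    F 0%R = f /\ forall m : int, residual_pair (F (m + 1)%R) (F m).

Definition in_FZ (f : int -> int) : Prop :=
  {homo f : x y / (x <= y)%O} /\ has_all_residuals f.

Record FZ := mkFZ { FZ_val :> int -> int; FZ_valP : `[< in_FZ FZ_val >] }.

HB.instance Definition _ := [isSub for FZ_val].
HB.instance Definition _ := [Choice of FZ by <:].

Lemma FZ_ext (f g : FZ) : FZ_val f =1 FZ_val g -> f = g.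
Proof. by move=> H; apply: val_inj; apply: funext. Qed.

Lemma FZ_homo (f : FZ) : {homo f : x y / (x <= y)%O}.
Proof. by have /asboolP[] := FZ_valP f. Qed.

Lemma FZ_residuals (f : FZ) : has_all_residuals f.
Proof. by have /asboolP[] := FZ_valP f. Qed.

Lemma residual_pair_homol (g f : int -> int) :
  residual_pair g f -> {homo g : x y / (x <= y)%O}.
Proof. by move=> gf x y xy; rewrite gf (le_trans xy) // -gf. Qed.

Lemma residual_pair_homor (g f : int -> int) :
  residual_pair g f -> {homo f : x y / (x <= y)%O}.
Proof. by move=> gf x y xy; rewrite -gf (le_trans _ xy) // gf. Qed.

Lemma in_FZ_of_family (F : int -> int -> int) (k : int) :
  (forall m : int, residual_pair (F (m + 1)%R) (F m)) -> in_FZ (F k).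
Proof.
move=> FP; split; first exact: residual_pair_homor (FP k).
exists (fun m => F (m + k)%R); rewrite add0r; split=> // m.
by rewrite addrAC; apply: FP.
Qed.

Lemma residual_uniql (g g' f : int -> int) :
  residual_pair g f -> residual_pair g' f -> g = g'.
Proof.
move=> H H'; apply: funext => x; apply: le_anti.
by rewrite H -H' lexx H' -H lexx.
Qed.

Lemma residual_uniqr (g f f' : int -> int) :
  residual_pair g f -> residual_pair g f' -> f = f'.
Proof.
move=> H H'; apply: funext => x; apply: le_anti.
by rewrite -H' H lexx -H H' lexx.
Qed.

Definition dual_residual (f : int -> int) : int -> int :=
  xget f [set g | residual_pair g f]%classic.

Definition residual (f : int -> int) : int -> int :=
  xget f [set g | residual_pair f g]%classic.

Lemma in_FZ_dual_residual (f : FZ) :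
  in_FZ (dual_residual f) /\ residual_pair (dual_residual f) f.
Proof.
have [F [F0 FP]] := FZ_residuals f.
have F1 : residual_pair (F 1%R) f by move: (FP 0%R); rewrite add0r F0.
have E : dual_residual f = F 1%R.
  by rewrite /dual_residual; case: xgetP => [g _ /residual_uniql/(_ F1)|/(_ (F 1%R))[]].
by rewrite E; split=> //; apply: in_FZ_of_family.
Qed.

Lemma in_FZ_residual (f : FZ) :
  in_FZ (residual f) /\ residual_pair f (residual f).
Proof.
have [F [F0 FP]] := FZ_residuals f.
have F1 : residual_pair f (F (-1)%R) by move: (FP (-1)%R); rewrite addNr F0.
have E : residual f = F (-1)%R.
  by rewrite /residual; case: xgetP => [g _ /residual_uniqr/(_ F1)|/(_ (F (-1)%R))[]].
by rewrite E; split=> //; apply: in_FZ_of_family.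
Qed.

(* Taking (dual) residuals reverses composition and exchanges meets and joins, *)
(* whence the alternation below.                                               *)
Lemma in_FZ_alternate (op op' : (int -> int) -> (int -> int) -> int -> int) (f g : FZ) :
  (forall a a' b b', residual_pair a' a -> residual_pair b' b ->
     residual_pair (op' a' b') (op a b)) ->
  (forall a a' b b', residual_pair a' a -> residual_pair b' b ->
     residual_pair (op a' b') (op' a b)) ->
  in_FZ (op f g).
Proof.
move=> H H'; have [F [<- FP]] := FZ_residuals f; have [G [<- GP]] := FZ_residuals g.
pose K (m : int) := (if odd `|m|%N then op' else op) (F m) (G m).
have KP (m : int) : residual_pair (K (m + 1)%R) (K m).
  rewrite /K; have -> : odd `|(m + 1)%R|%N = ~~ odd `|m|%N by lia.
  by case: odd => /=; [apply: H'|apply: H].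
exact: (in_FZ_of_family 0%R KP).
Qed.

Lemma in_FZ_id : in_FZ id.
Proof. by split=> //; exists (fun=> id). Qed.

Lemma in_FZ_comp (f g : FZ) : in_FZ (FZ_val f \o FZ_val g).
Proof.
apply: (@in_FZ_alternate (fun a b => a \o b) (fun a b => b \o a)).
  by move=> a a' b b' Ha Hb x y /=; rewrite Hb Ha.
by move=> a a' b b' Ha Hb x y /=; rewrite Ha Hb.
Qed.

Lemma in_FZ_meet (f g : FZ) : in_FZ (fun x => Order.min (f x) (g x)).
Proof.
apply: (@in_FZ_alternate (fun a b x => Order.min (a x) (b x))
                         (fun a b x => Order.max (a x) (b x))).
  by move=> a a' b b' Ha Hb x y /=; rewrite le_min ge_max Ha Hb.
move=> a a' b b' Ha Hb x y /=.
by rewrite le_max ge_min Ha Hb.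
Qed.

Lemma in_FZ_join (f g : FZ) : in_FZ (fun x => Order.max (f x) (g x)).
Proof.
apply: (@in_FZ_alternate (fun a b x => Order.max (a x) (b x))
                         (fun a b x => Order.min (a x) (b x))).
  move=> a a' b b' Ha Hb x y /=.
  by rewrite le_max ge_min Ha Hb.
by move=> a a' b b' Ha Hb x y /=; rewrite le_min ge_max Ha Hb.
Qed.

Definition FZ_one : FZ := mkFZ (asboolT in_FZ_id).
Definition FZ_mul (f g : FZ) : FZ := mkFZ (asboolT (in_FZ_comp f g)).
Definition FZ_meet (f g : FZ) : FZ := mkFZ (asboolT (in_FZ_meet f g)).
Definition FZ_join (f g : FZ) : FZ := mkFZ (asboolT (in_FZ_join f g)).
Definition FZ_linv (f : FZ) : FZ := mkFZ (asboolT (in_FZ_dual_residual f).1).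
Definition FZ_rinv (f : FZ) : FZ := mkFZ (asboolT (in_FZ_residual f).1).
Definition FZ_le (f g : FZ) : bool := `[< forall x : int, (f x <= g x)%O >].
Definition FZ_lt (f g : FZ) : bool := (g != f) && FZ_le f g.

Lemma FZ_mulA : associative FZ_mul.
Proof. by move=> f g h; apply: FZ_ext. Qed.

Lemma FZ_mul1 : left_id FZ_one FZ_mul.
Proof. by move=> f; apply: FZ_ext. Qed.

Lemma FZ_mulr1 : right_id FZ_one FZ_mul.
Proof. by move=> f; apply: FZ_ext. Qed.

HB.instance Definition _ := monoid.isMonoid.Build FZ FZ_mulA FZ_mul1 FZ_mulr1.

Lemma FZ_le_def (f g : FZ) : FZ_le f g = (FZ_meet f g == f).
Proof.
apply/asboolP/eqP => [H|E x]; first by apply: FZ_ext => x; exact/min_idPl/H.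
by rewrite -E ge_min lexx orbT.
Qed.

Lemma FZ_meetC : commutative FZ_meet.
Proof. by move=> f g; apply: FZ_ext => x; exact: minC. Qed.

Lemma FZ_joinC : commutative FZ_join.
Proof. by move=> f g; apply: FZ_ext => x; exact: maxC. Qed.

Lemma FZ_meetA : associative FZ_meet.
Proof. by move=> f g h; apply: FZ_ext => x; exact: minA. Qed.

Lemma FZ_joinA : associative FZ_join.
Proof. by move=> f g h; apply: FZ_ext => x; exact: maxA. Qed.

Lemma FZ_joinKI (g f : FZ) : FZ_meet f (FZ_join f g) = f.
Proof. by apply: FZ_ext => x; exact: (@joinKI _ int). Qed.

Lemma FZ_meetKU (g f : FZ) : FZ_join f (FZ_meet f g) = f.
Proof. by apply: FZ_ext => x; exact: (@meetKU _ int). Qed.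

Lemma FZ_meetUl : left_distributive FZ_meet FZ_join.
Proof. by move=> f g h; apply: FZ_ext => x; exact: (@meetUl _ int). Qed.

Lemma FZ_meetxx : idempotent_op FZ_meet.
Proof. by move=> f; apply: FZ_ext => x; exact: minxx. Qed.

Fact FZ_display : Order.disp_t. Proof. exact: (Order.Disp tt tt). Qed.

HB.instance Definition _ := Order.isMeetJoinDistrLattice.Build FZ_display FZ
  FZ_le_def (fun _ _ => erefl : FZ_lt _ _ = _) FZ_meetC FZ_joinC FZ_meetA FZ_joinA
  FZ_joinKI FZ_meetKU FZ_meetUl FZ_meetxx.

Lemma leFZP (f g : FZ) : reflect (forall x : int, (f x <= g x)%O) (f <= g)%O.
Proof. exact: asboolP. Qed.

Lemma FZ_leM2l (f g h : FZ) : (f <= g)%O -> (h * f <= h * g)%g%O.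
Proof. by move=> /leFZP fg; apply/leFZP => x; apply: FZ_homo. Qed.

Lemma FZ_leM2r (f g h : FZ) : (f <= g)%O -> (f * h <= g * h)%g%O.
Proof. by move=> /leFZP fg; apply/leFZP => x; apply: fg. Qed.

Lemma FZ_mulVl (f : FZ) : (FZ_linv f * f <= 1 :> FZ)%g%O.
Proof. by apply/leFZP => x /=; rewrite (in_FZ_dual_residual f).2. Qed.

Lemma FZ_mullV (f : FZ) : (1 <= f * FZ_linv f :> FZ)%g%O.
Proof. by apply/leFZP => x /=; rewrite -(in_FZ_dual_residual f).2. Qed.

Lemma FZ_mulrV (f : FZ) : (f * FZ_rinv f <= 1 :> FZ)%g%O.
Proof. by apply/leFZP => x /=; rewrite (in_FZ_residual f).2. Qed.

Lemma FZ_mulVr (f : FZ) : (1 <= FZ_rinv f * f :> FZ)%g%O.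
Proof. by apply/leFZP => x /=; rewrite -(in_FZ_residual f).2. Qed.

HB.instance Definition _ := isLPregroup.Build FZ_display FZ
  FZ_leM2l FZ_leM2r FZ_mulVl FZ_mullV FZ_mulrV FZ_mulVr.

Definition finite_support : pred FZ :=
  fun f => `[< finite_set [set x : int | f x != x]%classic >].

Record FZfs := mkFZfs { FZfs_val :> FZ; FZfs_valP : finite_support FZfs_val }.

HB.instance Definition _ := [isSub for FZfs_val].
HB.instance Definition _ := [Choice of FZfs by <:].

Lemma FZfs_finite (f : FZfs) : finite_set [set x : int | f x != x]%classic.
Proof. exact/asboolP/(FZfs_valP f). Qed.

Lemma finite_support_mul : mulg_closed finite_support.
Proof.
move=> f g /asboolP ff /asboolP fg; apply/asboolP.
apply: (@sub_finite_set _ _ ([set x | f x != x] `|` [set x | g x != x])%classic).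
  move=> x /= H; case: (eqVneq (g x) x) => gx; [left|right] => //.
  by move: H; rewrite gx.
by rewrite finite_setU.
Qed.

Lemma finite_support_monoid : monoid_closed finite_support.
Proof.
split; last exact: finite_support_mul.
apply/asboolP; rewrite (_ : [set _ | _]%classic = set0) //.
by apply/seteqP; split=> x //=; rewrite eqxx.
Qed.

Lemma finite_support_meet (f g : FZ) :
  f \in finite_support -> g \in finite_support -> (f `&` g)%O \in finite_support.
Proof.
move=> /asboolP ff /asboolP fg; apply/asboolP.
apply: (@sub_finite_set _ _ ([set x | f x != x] `|` [set x | g x != x])%classic).
  move=> x /= H; case: (eqVneq (g x) x) => gx; [left|right] => //.
  by apply/eqP => fx; move: H; rewrite fx gx minxx eqxx.
by rewrite finite_setU.
Qed.

Lemma finite_support_join (f g : FZ) :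
  f \in finite_support -> g \in finite_support -> (f `|` g)%O \in finite_support.
Proof.
move=> /asboolP ff /asboolP fg; apply/asboolP.
apply: (@sub_finite_set _ _ ([set x | f x != x] `|` [set x | g x != x])%classic).
  move=> x /= H; case: (eqVneq (g x) x) => gx; [left|right] => //.
  by apply/eqP => fx; move: H; rewrite fx gx maxxx eqxx.
by rewrite finite_setU.
Qed.

Lemma finite_support_linv (f : FZ) :
  f \in finite_support -> linv f \in finite_support.
Proof.
move=> /asboolP ff; apply/asboolP; set S := [set x | f x != x]%classic in ff.
apply: (@sub_finite_set _ _ (S `|` [set (x + 1)%R | x in S])%classic); last first.
  by rewrite finite_setU; split=> //; apply: finite_image.
move=> x /= H; case: (eqVneq (f x) x) => fx; [right|by left].
exists (x - 1)%R; last by rewrite subrK.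
apply/eqP => fx1; case/eqP: H; have P := (in_FZ_dual_residual f).2.
by have := P x x; have := P x (x - 1)%R; rewrite fx fx1; lia.
Qed.

Lemma finite_support_rinv (f : FZ) :
  f \in finite_support -> rinv f \in finite_support.
Proof.
move=> /asboolP ff; apply/asboolP; set S := [set x | f x != x]%classic in ff.
apply: (@sub_finite_set _ _ (S `|` [set (x - 1)%R | x in S])%classic); last first.
  by rewrite finite_setU; split=> //; apply: finite_image.
move=> x /= H; case: (eqVneq (f x) x) => fx; [right|by left].
exists (x + 1)%R; last by rewrite addrK.
apply/eqP => fx1; case/eqP: H; have P := (in_FZ_residual f).2.
by have := P x x; have := P (x + 1)%R x; rewrite fx fx1; lia.
Qed.

HB.instance Definition _ :=
  monoid.SubChoice_isSubMonoid.Build FZ finite_support FZfs finite_support_monoid.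
HB.instance Definition _ :=
  Order.SubChoice_isSubLattice.Build FZ_display FZ finite_support FZ_display FZfs
    finite_support_meet finite_support_join.

Lemma FZfs_valI : {morph FZfs_val : f g / (f `&` g)%O}.
Proof. exact: Order.valI_subproof. Qed.

Lemma FZfs_valU : {morph FZfs_val : f g / (f `|` g)%O}.
Proof. exact: Order.valU_subproof. Qed.

Lemma FZfs_valM : {morph FZfs_val : f g / (f * g)%g}.
Proof. exact: valM. Qed.

Lemma FZfs_val1 : FZfs_val 1%g = 1%g.
Proof. exact: val1. Qed.

Lemma FZfs_meetUl : @left_distributive FZfs FZfs Order.meet Order.join.
Proof.
move=> f g h; apply: val_inj; rewrite -[LHS]/(FZfs_val _) -[RHS]/(FZfs_val _).
by rewrite !(FZfs_valI, FZfs_valU) meetUl.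
Qed.

HB.instance Definition _ :=
  Order.Lattice_Meet_isDistrLattice.Build FZ_display FZfs FZfs_meetUl.

Definition FZfs_linv (f : FZfs) : FZfs := mkFZfs (finite_support_linv (FZfs_valP f)).
Definition FZfs_rinv (f : FZfs) : FZfs := mkFZfs (finite_support_rinv (FZfs_valP f)).

Lemma leFZfsE (f g : FZfs) : (f <= g)%O = (FZfs_val f <= FZfs_val g)%O.
Proof. by rewrite -Order.le_val. Qed.

Lemma FZfs_leM2l (f g h : FZfs) : (f <= g)%O -> (h * f <= h * g)%g%O.
Proof. by rewrite !leFZfsE !FZfs_valM; apply: lpg_leM2l. Qed.

Lemma FZfs_leM2r (f g h : FZfs) : (f <= g)%O -> (f * h <= g * h)%g%O.
Proof. by rewrite !leFZfsE !FZfs_valM; apply: lpg_leM2r. Qed.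

Lemma FZfs_mulVl (f : FZfs) : (FZfs_linv f * f <= 1 :> FZfs)%g%O.
Proof. by rewrite leFZfsE FZfs_valM FZfs_val1; apply: lpg_mulVl. Qed.

Lemma FZfs_mullV (f : FZfs) : (1 <= f * FZfs_linv f :> FZfs)%g%O.
Proof. by rewrite leFZfsE FZfs_valM FZfs_val1; apply: lpg_mullV. Qed.

Lemma FZfs_mulrV (f : FZfs) : (f * FZfs_rinv f <= 1 :> FZfs)%g%O.
Proof. by rewrite leFZfsE FZfs_valM FZfs_val1; apply: lpg_mulrV. Qed.

Lemma FZfs_mulVr (f : FZfs) : (1 <= FZfs_rinv f * f :> FZfs)%g%O.
Proof. by rewrite leFZfsE FZfs_valM FZfs_val1; apply: lpg_mulVr. Qed.

HB.instance Definition _ := isLPregroup.Build FZ_display FZfs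
  FZfs_leM2l FZfs_leM2r FZfs_mulVl FZfs_mullV FZfs_mulrV FZfs_mulVr.

(* Main.v *)
Require Import Defs.
From mathcomp Require Import all_boot all_order all_algebra.
From mathcomp Require Import zify.
From mathcomp Require Import boolp classical_sets cardinality.

(* Send each point of the diagram to its rank in Z, so that the covering pairs *)
(* of the c-chain become pairs of consecutive integers. An order-preserving    *)
(* partial function on the ranks 0, ..., M-1 extends to Z by running maxima    *)
(* inside [0, M) and by the identity outside. If F extends g and a, b are      *)
(* consecutive integers with F a < x <= F b, then the dual residual of F takes *)
(* the value b at x; hence the (dual) residuals of F extend those of g, and    *)
(* the point of Z corresponding to p witnesses the failure.                    *)

Set Implicit Arguments.
Unset Strict Implicit.
Unset Printing Implicit Defensive.

Import Order.TTheory GRing.Theory Num.Theory.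
Local Open Scope ring_scope.

(** Extending the partial functions from ranks to all of Z carries the failure over. The extensions
    lie in [FZfs] because a monotone map of Z with displacement at most K has a residual and a dual
    residual with the same bound, hence residuals of all orders ([in_FZ_displacement_le]). By
    induction on intentional terms ([extends_intentional_hom]), every evaluated term extends its
    partial function, so at the rank of p each joinand, and hence the join, lies strictly below the
    identity. If e were valid in [FZfs], so would be the equivalent intentional equation, a
    contradiction. *)

Definition displacement_le (K : nat) (f : int -> int) : Prop :=
  forall x : int, (x - K%:Z <= f x <= x + K%:Z).

Lemma dual_residual_exists (K : nat) (f : int -> int) :
  {homo f : x y / x <= y} -> displacement_le K f ->
  exists g, residual_pair g f /\ displacement_le K g.
Proof.
move=> f_homo fK.
have /boolp.choice[g gP] (x : int) :
    exists z, (forall y : int, (z <= y) = (x <= f y)) /\ (x - K%:Z <= z <= x + K%:Z).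
  (* The dual residual at x is the least z with x <= f z. Bounded displacement confines it to the
     window from x - K to x + K, so it is searched for from the left end. *)
  have x0 : x <= f (x - K%:Z + (K + K)%N%:Z).
    by have := fK (x - K%:Z + (K + K)%N%:Z); lia.
  have [j xj jmin] := ex_minnP (ex_intro (fun j => x <= f (x - K%:Z + j%:Z)) _ x0).
  exists (x - K%:Z + j%:Z); split=> [y|]; last by have := jmin _ x0; lia.
  apply/idP/idP => [/f_homo|xy]; first exact: le_trans.
  have yK : x - K%:Z <= y by have := fK y; lia.
  have := jmin (absz (y - (x - K%:Z))%R).
  have -> : x - K%:Z + (absz (y - (x - K%:Z))%R)%:Z = y by lia.
  by move=> /(_ xy); lia.
exists g; split=> [x y|x]; first exact: (gP x).1.
exact: (gP x).2.
Qed.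

(* Conjugation by x |-> -x exchanges residuals and dual residuals. *)
Lemma residual_exists (K : nat) (f : int -> int) :
  {homo f : x y / x <= y} -> displacement_le K f ->
  exists g, residual_pair f g /\ displacement_le K g.
Proof.
move=> f_homo fK.
have [x y xy|x|g [gf gK]] := @dual_residual_exists K (fun x => - f (- x)).
- by rewrite lerN2; apply: f_homo; rewrite lerN2.
- by have := fK (- x); lia.
exists (fun x => - g (- x)); split=> [x y|x].
  by have := gf (- y) (- x); rewrite opprK; lia.
by have := gK (- x); lia.
Qed.

Lemma in_FZ_displacement_le (K : nat) (f : int -> int) :
  {homo f : x y / x <= y} -> displacement_le K f -> in_FZ f.
Proof.
move=> f_homo fK; split=> //.
pose P g := {homo g : x y / (x <= y :> int)} /\ displacement_le K g.
(* [L] and [R] must be total to be iterated; outside [P] their value is arbitrary. *)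
have /boolp.choice[L LP] g : exists h, P g -> P h /\ residual_pair h g.
  have [[gh gK]|nP] := pselect (P g); last by exists g.
  have [h [hg hK]] := dual_residual_exists gh gK.
  by exists h => _; split=> //; split=> //; apply: residual_pair_homol hg.
have /boolp.choice[R RP] g : exists h, P g -> P h /\ residual_pair g h.
  have [[gh gK]|nP] := pselect (P g); last by exists g.
  have [h [hg hK]] := residual_exists gh gK.
  by exists h => _; split=> //; split=> //; apply: residual_pair_homor hg.
have PL k : P (iter k L f) by elim: k => // k IH; exact: (LP _ IH).1.
have PR k : P (iter k R f) by elim: k => // k IH; exact: (RP _ IH).1.
exists (fun m => match m with Posz k => iter k L f | Negz k => iter k.+1 R f end).
split=> // -[k|k].
  by rewrite -PoszD addn1; exact: (LP _ (PL k)).2.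
(* For k = 0 the successor index is 0, where the family passes from the [R] branch to the [L]
   branch. *)
have -> : Negz k + 1 = - k%:Z by lia.
by case: k => [|k]; [exact: (RP _ (PR 0)).2|rewrite -NegzE; exact: (RP _ (PR k.+1)).2].
Qed.

Lemma FZfs_of_homo (M : nat) (f : int -> int) :
  {homo f : x y / x <= y} ->
  (forall x : int, ~~ (0 <= x < M%:Z) -> f x = x) ->
  (forall x : int, 0 <= x < M%:Z -> 0 <= f x < M%:Z) ->
  exists F : FZfs, forall x, FZ_val F x = f x.
Proof.
move=> f_homo f_id f_stable.
have fM : displacement_le M f.
  move=> x; have [xM|/f_id ->] := boolP (0 <= x < M%:Z); last by lia.
  by have := f_stable _ xM; lia.
pose F := mkFZ (asboolT (in_FZ_displacement_le f_homo fM)).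
suff Ffin : finite_support F by exists (mkFZfs Ffin).
apply/asboolP; apply: (@sub_finite_set _ _ [set Posz k | k in `I_M]%classic).
  move=> x /= fx; have [xM|/f_id fxx] := boolP (0 <= x < M%:Z); last by rewrite fxx eqxx in fx.
  by exists `|x|%N; lia.
exact: finite_image (finite_II M).
Qed.

Section Diagram.
Variable C : cchain.

Definition rank (a : C) : nat := #|[pred b : C | (b < a)%O]|.

Lemma rank_lt_card (a : C) : (rank a < #|C|)%N.
Proof.
apply: proper_card; apply/properP; split; first by apply/fintype.subsetP.
by exists a; rewrite ?inE ?ltxx.
Qed.

Lemma rank_lt (a b : C) : (rank a < rank b)%N = (a < b)%O.
Proof.
apply/idP/idP => [|ab]; last first.
  apply: proper_card; apply/properP; split; last by exists a; rewrite !inE ?ltxx.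
  by apply/fintype.subsetP => c; rewrite !inE => /lt_trans; apply.
apply: contraTT; rewrite -leNgt -leqNgt => ba; apply: subset_leq_card.
by apply/fintype.subsetP => c; rewrite !inE => /lt_le_trans; apply.
Qed.

Lemma rank_le (a b : C) : (rank a <= rank b)%N = (a <= b)%O.
Proof. by rewrite leqNgt rank_lt leNgt. Qed.

Lemma rank_cov (a b : C) : cc_cov a b -> rank b = (rank a).+1.
Proof.
move=> ab; have /andP[ltab _] := cc_covP ab.
rewrite /rank (cardD1 a) !inE ltab add1n; congr _.+1; apply: eq_card => c.
rewrite !inE; apply/andP/idP => [[ca /(cc_cov_le ab)]|ca].
  by rewrite le_eqVlt (negbTE ca).
by rewrite (lt_eqF ca) (lt_trans ca).
Qed.

(** Nothing is asked where g is undefined, so a composite or inverse with a smaller domain is still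
    extended. *)
Definition extends (F : int -> int) (g : {ffun C -> option C}) : Prop :=
  forall a b, g a = Some b -> F (rank a)%:Z = (rank b)%:Z.

Lemma extension_exists (g : pfun C) : exists F : FZfs, extends F g.
Proof.
(* The running maximum; points outside the domain of g contribute 0, which is neutral for max. *)
pose m (k : nat) : nat := \max_(a : C | (rank a <= k)%N) oapp rank 0%N (g a).
have m_lt k : (k < #|C|)%N -> (m k < #|C|)%N.
  move=> kC; rewrite /m; elim/big_ind: _ => [|u v uC vC|a _]; [exact: leq_ltn_trans kC| |].
    by rewrite gtn_max uC.
  by case: (g a) => [b|] /=; [exact: rank_lt_card|exact: leq_ltn_trans kC].
have m_homo k l : (k <= l)%N -> (m k <= m l)%N.
  move=> kl; apply/bigmax_leqP => a ak.
  by apply: (bigop.bigmax_sup a) => //; apply: leq_trans kl.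
have m_ext a b : g a = Some b -> m (rank a) = rank b.
  move=> gab; apply/eqP; rewrite eqn_leq; apply/andP; split; last first.
    by apply: (bigop.bigmax_sup a); rewrite ?gab.
  apply/bigmax_leqP => a'; rewrite rank_le => a'a; case ga': (g a') => [b'|] //=.
  by rewrite rank_le; apply: (pf_homoP _ (pf_valP g)) a'a ga' gab.
pose f (x : int) : int := if 0 <= x < #|C|%:Z then (m `|x|%N)%:Z else x.
have [x y xy|x /negbTE xC|x xC|F FP] := @FZfs_of_homo #|C| f.
- have := @m_homo `|x|%N `|y|%N; have := m_lt `|x|%N; have := m_lt `|y|%N.
  by rewrite /f; case: ifP; case: ifP; lia.
- by rewrite /f xC.
- by have := m_lt `|x|%N; rewrite /f xC; lia.
exists F => a b gab; rewrite FP /f.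
have aC : 0 <= (rank a)%:Z < #|C|%:Z by have := rank_lt_card a; lia.
by rewrite aC absz_nat (m_ext _ _ gab).
Qed.

(** In ranks, x <= F b gives G x <= b, while F a < x excludes G x <= a; since b = a + 1, this forces
    G x = b. *)
Lemma extends_linv (F G : int -> int) (g : {ffun C -> option C}) :
  residual_pair G F -> extends F g -> extends G (pf_linv_fun g).
Proof.
move=> GF Fg x b /pf_linv_fun_some[a [u [v [/rank_cov ab /Fg Fa /Fg Fb]]]].
rewrite -rank_lt -rank_le => ux xv.
have := GF (rank x)%:Z (rank a)%:Z; have := GF (rank x)%:Z (rank b)%:Z.
by rewrite Fa Fb; lia.
Qed.

Lemma extends_rinv (F G : int -> int) (g : {ffun C -> option C}) :
  residual_pair F G -> extends F g -> extends G (pf_rinv_fun g).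
Proof.
move=> FG Fg x a /pf_rinv_fun_some[b [u [v [/rank_cov ab /Fg Fa /Fg Fb]]]].
rewrite -rank_lt -rank_le => ux xv.
have := FG (rank a)%:Z (rank x)%:Z; have := FG (rank b)%:Z (rank x)%:Z.
by rewrite Fa Fb; lia.
Qed.

Lemma extends_intentional_hom n (psi : iterm n -> pfun C) (v : 'I_n -> FZfs) :
  intentional_hom psi -> (forall i, extends (v i) (psi (IVar i))) ->
  forall t, extends (teval v (term_of_iterm t)) (psi t).
Proof.
move=> [psi1 psiM psiL psiR] vP; elim=> [i||s IHs t IHt|t IHt|t IHt] /=.
- exact: vP.
- by rewrite psi1 => a b; rewrite ffunE => -[->].
- rewrite psiM => a c; rewrite ffunE /=.
  by case ta: (pf_val _ a) => [b|] //= sb /=; rewrite (IHt _ _ ta) (IHs _ _ sb).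
- by rewrite psiL; apply: extends_linv IHt; exact: (in_FZ_dual_residual _).2.
- by rewrite psiR; apply: extends_rinv IHt; exact: (in_FZ_residual _).2.
Qed.

End Diagram.

Lemma teval_ijoin_lt n (i : iequation n) (v : 'I_n -> FZfs) (x y : int) :
  (forall w, w \in ihead i :: itail i ->
     FZ_val (teval v (term_of_iterm (iprod w))) x < y) ->
  FZ_val (teval v (ijoin i)) x < y.
Proof.
case: i => w ws /=; rewrite /ijoin /= => H.
have : FZ_val (teval v (term_of_iterm (iprod w))) x < y by apply: H; rewrite mem_head.
have {H} : forall w, w \in ws -> FZ_val (teval v (term_of_iterm (iprod w))) x < y.
  by move=> w' w'ws; apply: H; rewrite inE w'ws orbT.
(* The first joinand is generalized to any t because [foldl] accumulates the join there. *)
elim: ws (term_of_iterm _) => //= w' ws IH t H tx.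
apply: IH => [w'' w''ws|]; first by apply: H; rewrite inE w''ws orbT.
by rewrite [teval _ _]/= FZfs_valU gt_max tx H ?mem_head.
Qed.

Theorem theorem4p1 (e : equation nat) (n : nat) (D : diagram n) :
  fails_in_diagram e D -> fails_in FZfs e.
Proof.
move=> [i [e_i [psi [psi_hom psi_var [p pP]]]]].
apply: contrapT => nfail.
have e_valid : valid FZfs e.
  by move=> v; apply: contrapT => nv; apply: nfail; exists v.
have /boolp.choice[v vP] j : exists F : FZfs, extends F (psi (IVar j)).
  exact: extension_exists.
(* The equivalence applies because [FZfs] is itself a distributive l-pregroup. *)
have one_le : (1 = 1 `&` teval v (ijoin i) :> FZfs)%g%O := (e_i _ FZfs).1 e_valid v.
have ijoin_lt : FZ_val (teval v (ijoin i)) (rank p)%:Z < (rank p)%:Z.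
  apply: teval_ijoin_lt => w /pP[a [b [+ pw ba]]].
  have [-> _ _ _] := psi_hom; rewrite ffunE => -[pa].
  by rewrite (extends_intentional_hom psi_hom vP pw) ltz_nat rank_lt pa.
have : FZ_val (1 : FZfs)%g (rank p)%:Z = (rank p)%:Z by [].
by rewrite one_le FZfs_valI /=; lia.
Qed.
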